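(* The lattice of subvarieties of $\mathbf{RDQDStSH_1}$ is isomorphic to $(\mathbf{1}+\mathbf{B_9})\times(\mathbf{1}+\mathbf{B_5})\times\mathbf{B_9}$.
   Context: A semi-Heyting algebra is an algebra $\langle L,\vee,\wedge,\to,0,1\rangle$ such that $\langle L,\vee,\wedge,0,1\rangle$ is a bounded lattice and the identities $x\wedge(x\to y)\approx x\wedge y$, $x\wedge(y\to z)\approx x\wedge((x\wedge y)\to(x\wedge z))$ and $x\to x\approx 1$ hold; write $x^*:=x\to 0$. A dually quasi-De Morgan semi-Heyting algebra is an expansion $\langle L,\vee,\wedge,\to,',0,1\rangle$ of a semi-Heyting algebra by a unary operation $'$ satisfying $0'\approx 1$, $1'\approx 0$, $(x\wedge y)'\approx x'\vee y'$, $(x\vee y)''\approx x''\vee y''$ and $x''\le x$. Notation: $x'^*:=(x')^*$, $x^+:=((x')^* )'$. Such an algebra has level 1 if it satisfies $x\wedge x'^*\wedge ((x'^* )')^*\approx x\wedge x'^*$; it is Stone if it satisfies $x^*\vee x^{**}\approx 1$; it is regular if it satisfies $x\wedge x^+\le y\vee y^*$. $\mathbf{RDQDStSH_1}$ denotes the variety of regular dually quasi-De Morgan Stone semi-Heyting algebras of level 1. For a positive integer $n$, $\mathbf{B_n}$ denotes the Boolean lattice with $n$ atoms, and for a lattice $\mathbf{B}$, $\mathbf{1}+\mathbf{B}$ denotes the lattice obtained from $\mathbf{B}$ by adjoining a new least element. *)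

(* Defs.v *)
From Stdlib Require List.
From HB Require Import structures.
From mathcomp Require Import all_boot all_order.
From mathcomp Require Import boolp.

Set Implicit Arguments.
Unset Strict Implicit.
Unset Printing Implicit Defensive.

Import Order.TTheory.

(** * Algebras of type <join, meet, imp, ', 0, 1> and their identities *)

Record algebra := Algebra {
  carrier :> Type;
  ajoin : carrier -> carrier -> carrier;
  ameet : carrier -> carrier -> carrier;
  aimp : carrier -> carrier -> carrier;
  aprime : carrier -> carrier;
  azero : carrier;
  aone : carrier }.

Inductive term :=
  | Var of nat
  | Join of term & term
  | Meet of term & term
  | Imp of term & term
  | Prime of term
  | Zero
  | One.

Fixpoint eval (A : algebra) (v : nat -> A) (t : term) : A :=
  match t with
  | Var n => v n
  | Join s t => ajoin (eval v s) (eval v t)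
  | Meet s t => ameet (eval v s) (eval v t)
  | Imp s t => aimp (eval v s) (eval v t)
  | Prime s => aprime (eval v s)
  | Zero => azero A
  | One => aone A
  end.

Record identity := Identity { lhs : term; rhs : term }.

Definition satisfies (A : algebra) (e : identity) : Prop :=
  forall v : nat -> A, eval v (lhs e) = eval v (rhs e).

Definition models (E : identity -> Prop) (A : algebra) : Prop :=
  forall e, E e -> satisfies A e.

(** * Varieties *)

Definition is_variety (K : algebra -> Prop) : Prop :=
  exists E : identity -> Prop, forall A, K A <-> models E A.

Record variety := Variety {
  in_variety :> algebra -> Prop;
  in_variety_is_variety : is_variety in_variety }.

Lemma models_is_variety (E : identity -> Prop) : is_variety (models E).
Proof. by exists E. Qed.

Definition Mod (E : identity -> Prop) : variety :=
  Variety (models_is_variety E).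

Definition theory (K : algebra -> Prop) (e : identity) : Prop :=
  forall A, K A -> satisfies A e.

Record subvariety (V : variety) := Subvariety {
  in_subvariety :> algebra -> Prop;
  subvariety_is_variety : is_variety in_subvariety;
  subvariety_sub : forall A, in_subvariety A -> V A }.

Lemma subvariety_eq (V : variety) (K L : subvariety V) :
  (forall A, K A <-> L A) -> K = L.
Proof.
case: K L => [K vK sK] [L vL sL] /= KL.
have eKL : K = L by apply/funext => A; apply/propext.
by subst L; rewrite (Prop_irrelevance vK vL) (Prop_irrelevance sK sL).
Qed.

HB.instance Definition _ (V : variety) := gen_eqMixin (subvariety V).
HB.instance Definition _ (V : variety) := gen_choiceMixin (subvariety V).

Definition subvariety_le (V : variety) (K L : subvariety V) : bool :=
  `[< forall A, K A -> L A >].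

Lemma subvariety_le_refl (V : variety) : reflexive (@subvariety_le V).
Proof. by move=> K; apply/asboolP. Qed.

Lemma subvariety_le_anti (V : variety) : antisymmetric (@subvariety_le V).
Proof.
move=> K L /andP[/asboolP KL /asboolP LK].
by apply: subvariety_eq => A; split; [apply: KL | apply: LK].
Qed.

Lemma subvariety_le_trans (V : variety) : transitive (@subvariety_le V).
Proof.
move=> L K M /asboolP KL /asboolP LM; apply/asboolP => A /KL; exact: LM.
Qed.

Fact subvariety_display : Order.disp_t.
Proof. exact: Order.Disp tt tt. Qed.

HB.instance Definition _ (V : variety) :=
  Order.Le_isPOrder.Build subvariety_display (subvariety V)
    (@subvariety_le_refl V) (@subvariety_le_anti V) (@subvariety_le_trans V).

Lemma subvariety_meet_is_variety (V : variety) (K L : subvariety V) :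
  is_variety (fun A => K A /\ L A).
Proof.
have [EK hK] := subvariety_is_variety K; have [EL hL] := subvariety_is_variety L.
exists (fun e => EK e \/ EL e) => A; split.
  by move=> [/hK AK /hL AL] e [/AK|/AL].
by move=> AE; split; [apply/hK | apply/hL] => e Ee; apply: AE; [left | right].
Qed.

Definition subvariety_meet (V : variety) (K L : subvariety V) : subvariety V :=
  Subvariety (subvariety_meet_is_variety K L)
    (fun A KLA => subvariety_sub (proj1 KLA)).

Lemma subvariety_join_sub (V : variety) (K L : subvariety V) A :
  models (theory (fun A => K A \/ L A)) A -> V A.
Proof.
have [EV hV] := in_variety_is_variety V => hA; apply/hV => e Ee.
by apply: hA => B [] /subvariety_sub/hV; apply.
Qed.

(* the variety generated by the union of K and L *)
Definition subvariety_join (V : variety) (K L : subvariety V) : subvariety V :=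
  Subvariety (models_is_variety (theory (fun A => K A \/ L A)))
    (@subvariety_join_sub V K L).

Lemma subvariety_meetP (V : variety) (K L M : subvariety V) :
  (K <= subvariety_meet L M)%O = ((K <= L)%O && (K <= M)%O).
Proof.
apply/asboolP/andP => [h|[/asboolP h1 /asboolP h2] A KA]; last first.
  by split; [apply: h1 | apply: h2].
by split; apply/asboolP => A /h[].
Qed.

Lemma subvariety_joinP (V : variety) (K L M : subvariety V) :
  (subvariety_join K L <= M)%O = ((K <= M)%O && (L <= M)%O).
Proof.
apply/asboolP/andP => [h|[/asboolP h1 /asboolP h2] A].
  by split; apply/asboolP => A KA; apply: h => e; apply; [left | right].
have [EM hM] := subvariety_is_variety M => hA; apply/hM => e Ee.
by apply: hA => B [/h1|/h2] /hM; apply.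
Qed.

HB.instance Definition _ (V : variety) :=
  Order.POrder_MeetJoin_isLattice.Build subvariety_display (subvariety V)
    (@subvariety_meetP V) (@subvariety_joinP V).

(** * The variety RDQDStSH_1 *)

Declare Scope term_scope.
Delimit Scope term_scope with term.
Bind Scope term_scope with term.
Notation "s ⊓ t" := (Meet s t) (at level 40, left associativity) : term_scope.
Notation "s ⊔ t" := (Join s t) (at level 50, left associativity) : term_scope.
Notation "s ⇒ t" := (Imp s t) (at level 55, right associativity) : term_scope.
Notation "s ≈ t" := (Identity s%term t%term) (at level 70, no associativity).
Notation "s ≼ t" := (Identity (Meet s%term t%term) s%term)
  (at level 70, no associativity).

Definition star (t : term) : term := Imp t Zero.
Definition plus (t : term) : term := Prime (star (Prime t)).

Local Notation x := (Var 0).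
Local Notation y := (Var 1).
Local Notation z := (Var 2).

Definition bounded_lattice_ids : seq identity :=
  [:: x ⊔ y ≈ y ⊔ x;
      x ⊓ y ≈ y ⊓ x;
      x ⊔ (y ⊔ z) ≈ (x ⊔ y) ⊔ z;
      x ⊓ (y ⊓ z) ≈ (x ⊓ y) ⊓ z;
      x ⊔ (x ⊓ y) ≈ x;
      x ⊓ (x ⊔ y) ≈ x;
      Zero ⊓ x ≈ Zero;
      x ⊔ One ≈ One].

Definition semi_Heyting_ids : seq identity :=
  bounded_lattice_ids ++
  [:: x ⊓ (x ⇒ y) ≈ x ⊓ y;
      x ⊓ (y ⇒ z) ≈ x ⊓ ((x ⊓ y) ⇒ (x ⊓ z));
      x ⇒ x ≈ One].

Definition dually_quasi_De_Morgan_ids : seq identity :=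
  [:: Prime Zero ≈ One;
      Prime One ≈ Zero;
      Prime (x ⊓ y) ≈ Prime x ⊔ Prime y;
      Prime (Prime (x ⊔ y)) ≈ Prime (Prime x) ⊔ Prime (Prime y);
      Prime (Prime x) ≼ x].

Definition level1_id : identity :=
  x ⊓ star (Prime x) ⊓ star (Prime (star (Prime x))) ≈ x ⊓ star (Prime x).

Definition Stone_id : identity := star x ⊔ star (star x) ≈ One.

Definition regular_id : identity := x ⊓ plus x ≼ y ⊔ star y.

Definition RDQDStSH1 : variety :=
  Mod (fun e => List.In e
    (semi_Heyting_ids ++ dually_quasi_De_Morgan_ids ++
     [:: level1_id; Stone_id; regular_id])).

(** * The lattice 1 + B *)

Variant adjoin_bottom (T : Type) := NewBottom | Old of T.
Arguments NewBottom {T}.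
Arguments Old {T} _.

Definition option_of_adjoin (T : Type) (a : adjoin_bottom T) : option T :=
  if a is Old u then Some u else None.
Definition adjoin_of_option (T : Type) (o : option T) : adjoin_bottom T :=
  if o is Some u then Old u else NewBottom.
Lemma option_of_adjoinK (T : Type) :
  cancel (@option_of_adjoin T) (@adjoin_of_option T).
Proof. by case. Qed.

HB.instance Definition _ (T : choiceType) :=
  Choice.copy (adjoin_bottom T) (can_type (@option_of_adjoinK T)).

Definition adjoin_le d (T : latticeType d) (a b : adjoin_bottom T) : bool :=
  match a, b with
  | NewBottom, _ => true
  | Old _, NewBottom => false
  | Old u, Old v => (u <= v)%O
  end.

Lemma adjoin_le_refl d (T : latticeType d) : reflexive (@adjoin_le d T).
Proof. by case=> //= u. Qed.

Lemma adjoin_le_anti d (T : latticeType d) : antisymmetric (@adjoin_le d T).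
Proof. by case=> [|u] [|v] //= /le_anti ->. Qed.

Lemma adjoin_le_trans d (T : latticeType d) : transitive (@adjoin_le d T).
Proof. by case=> [|u] [|v] [|w] //=; apply: le_trans. Qed.

HB.instance Definition _ d (T : latticeType d) :=
  Order.Le_isPOrder.Build d (adjoin_bottom T)
    (@adjoin_le_refl d T) (@adjoin_le_anti d T) (@adjoin_le_trans d T).

Definition adjoin_meet d (T : latticeType d) (a b : adjoin_bottom T) :
    adjoin_bottom T :=
  match a, b with
  | Old u, Old v => Old (u `&` v)%O
  | _, _ => NewBottom
  end.

Definition adjoin_join d (T : latticeType d) (a b : adjoin_bottom T) :
    adjoin_bottom T :=
  match a, b with
  | Old u, Old v => Old (u `|` v)%O
  | NewBottom, _ => b
  | _, NewBottom => a
  end.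

Lemma adjoin_meetP d (T : latticeType d) (a b c : adjoin_bottom T) :
  (a <= adjoin_meet b c)%O = ((a <= b)%O && (a <= c)%O).
Proof.
by case: a b c => [|u] [|v] [|w] //=; rewrite /Order.le/= ?andbF// lexI.
Qed.

Lemma adjoin_joinP d (T : latticeType d) (a b c : adjoin_bottom T) :
  (adjoin_join a b <= c)%O = ((a <= c)%O && (b <= c)%O).
Proof.
by case: a b c => [|u] [|v] [|w] //=; rewrite /Order.le/= ?andbT// leUx.
Qed.

HB.instance Definition _ d (T : latticeType d) :=
  Order.POrder_MeetJoin_isLattice.Build d (adjoin_bottom T)
    (@adjoin_meetP d T) (@adjoin_joinP d T).

(** * The Boolean lattice with n atoms: subsets of 'I_n ordered by inclusion *)

Export Order.DefaultSetSubsetOrder.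
Notation boolean_lattice n := {set 'I_n} (only parsing).

(** * Isomorphism of lattices *)

Definition lattice_isomorphic d (L : latticeType d) d' (M : latticeType d') :
    Prop :=
  exists f : {lmorphism L -> M}, bijective f.

(* Main.v *)
(** In an algebra of the variety call [c] central when [c `&` c' = 0].  Then [c] is
    complemented with complement [c'], so the central elements form a Boolean
    algebra, and each of its ultrafilters [F] yields the congruence "[x] and [y]
    agree below some [c] in [F]".  Level 1 says precisely that every
    [delta x = x `&` x'^*] is central; hence these quotients separate points and
    satisfy [delta x = 0] for [x <> 1].  In such a quotient regularity leaves at
    most one dense element [a <> 1].  If there is one, the Stone identity forces the
    chain [0 < a < 1] with [a'] equal to [a] or [1]; otherwise the lattice is Boolean
    with [s' = s] for all [s] other than [0] and [1], hence has at most four elements.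
    This gives 2 + 20 + 3 algebras, the only embeddings between distinct ones being
    those of the two-element algebras.  A subvariety is determined by which of them
    it contains, and every down-closed choice occurs because [delta] turns the
    diagram of each algebra into an identity refuted exactly by the algebras
    containing it.  Grouping the algebras by the value of [0 -> 1] (equal to [1],
    equal to [0], or neither) gives the three factors. *)

From HB Require Import structures.
From mathcomp Require Import all_boot all_order.
From mathcomp Require Import boolp classical_sets.
Require Import Defs.

Set Implicit Arguments.
Unset Strict Implicit.
Unset Printing Implicit Defensive.

Import Order.TTheory.

(** * Homomorphisms *)

Section Homomorphisms.
Variables (A B : algebra) (h : A -> B).

Definition homomorphism : Prop :=
  [/\ {morph h : x y / ajoin x y >-> ajoin x y},
      {morph h : x y / ameet x y >-> ameet x y},
      {morph h : x y / aimp x y >-> aimp x y},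
      {morph h : x / aprime x >-> aprime x}
    & h (azero A) = azero B /\ h (aone A) = aone B].

Definition surjection : Prop := forall y, exists x, h x = y.

Lemma eval_hom v t : homomorphism -> h (eval v t) = eval (h \o v) t.
Proof.
move=> [hU hI himp hp [h0 h1]].
by elim: t => //= [s <- t <-|s <- t <-|s <- t <-|s <-].
Qed.

Lemma satisfies_inj e :
  homomorphism -> injective h -> satisfies B e -> satisfies A e.
Proof. by move=> hh hi He v; apply: hi; rewrite !eval_hom. Qed.

Lemma satisfies_surj e :
  homomorphism -> surjection -> satisfies A e -> satisfies B e.
Proof.
move=> hh hs He v.
have [w hw] := boolp.choice (fun n => hs (v n)).
have -> : v = h \o w by apply/funext => n /=.
by rewrite -!eval_hom // He.
Qed.

End Homomorphisms.

Section Quotient.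
Variables (A : algebra) (R : A -> A -> Prop).
Hypotheses (Rrefl : forall x, R x x) (Rsym : forall x y, R x y -> R y x)
  (Rtrans : forall x y z, R x y -> R y z -> R x z)
  (RU : forall x x' y y', R x x' -> R y y' -> R (ajoin x y) (ajoin x' y'))
  (RI : forall x x' y y', R x x' -> R y y' -> R (ameet x y) (ameet x' y'))
  (Rimp : forall x x' y y', R x x' -> R y y' -> R (aimp x y) (aimp x' y'))
  (Rpr : forall x x', R x x' -> R (aprime x) (aprime x')).

(** A class is the predicate [R x] itself; by extensionality [proj] then identifies exactly the
    [R]-related elements. *)
Definition quotient_carrier := {P : A -> Prop | exists x, P = R x}.

Definition proj (x : A) : quotient_carrier :=
  exist _ (R x) (ex_intro _ x erefl).

Definition lift (q : quotient_carrier) : A := sval (cid (svalP q)).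

Definition quotient : algebra := Algebra
  (fun p q => proj (ajoin (lift p) (lift q)))
  (fun p q => proj (ameet (lift p) (lift q)))
  (fun p q => proj (aimp (lift p) (lift q)))
  (fun p => proj (aprime (lift p))) (proj (azero A)) (proj (aone A)).

Lemma proj_eq x y : proj x = proj y <-> R x y.
Proof.
split=> [/(congr1 sval)/= E|Rxy]; first by rewrite E.
apply: eq_exist => /=; apply/funext => z; apply/propext.
by split=> H; [apply: Rtrans H; apply: Rsym | apply: Rtrans H].
Qed.

Lemma liftK : cancel lift proj.
Proof.
move=> [P exP]; apply: eq_exist; rewrite /lift; case: cid => x /=; exact: esym.
Qed.

Lemma lift_proj x : R x (lift (proj x)).
Proof. by apply/proj_eq; rewrite liftK. Qed.

Lemma proj_hom : @homomorphism A quotient proj.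
Proof.
split=> [x y|x y|x y|x|//]; apply (proj2 (proj_eq _ _));
  [apply: RU | apply: RI | apply: Rimp | apply: Rpr]; exact: lift_proj.
Qed.

Lemma proj_surj : @surjection A quotient proj.
Proof. by move=> q; exists (lift q); apply: liftK. Qed.

End Quotient.

(** * The algebras of RDQDStSH1 as distributive lattices *)

Local Notation "'X" := (Var 0).
Local Notation "'Y" := (Var 1).
Local Notation "'Z" := (Var 2).

Definition valuation3 (A : algebra) (x y z : A) (n : nat) : A :=
  match n with 0 => x | 1 => y | _ => z end.

Ltac in_axioms := repeat (first [left; reflexivity | right]).

Local Notation ax HA e x y z :=
  (HA e ltac:(in_axioms) (valuation3 x y z)) (only parsing).

(** The alias carries the proof of membership, so that order instances resting on the axioms can be
    attached to the carrier. *)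
Definition lattice_of (A : algebra) of RDQDStSH1 A : Type := A.

Section Structure.
Variables (A : algebra) (HA : RDQDStSH1 A).
Notation T := (lattice_of HA).
Implicit Types x y z : T.

Let join (x y : T) : T := @ajoin A x y.
Let meet (x y : T) : T := @ameet A x y.
Let le (x y : T) : bool := `[< meet x y = x >].
Definition imp (x y : T) : T := @aimp A x y.
Definition prime (x : T) : T := @aprime A x.

Let joinC x y : join x y = join y x.
Proof. exact: (ax HA ('X ⊔ 'Y ≈ 'Y ⊔ 'X) x y x). Qed.
Let meetC x y : meet x y = meet y x.
Proof. exact: (ax HA ('X ⊓ 'Y ≈ 'Y ⊓ 'X) x y x). Qed.
Let joinA x y z : join x (join y z) = join (join x y) z.
Proof. exact: (ax HA ('X ⊔ ('Y ⊔ 'Z) ≈ 'X ⊔ 'Y ⊔ 'Z) x y z). Qed.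
Let meetA x y z : meet x (meet y z) = meet (meet x y) z.
Proof. exact: (ax HA ('X ⊓ ('Y ⊓ 'Z) ≈ 'X ⊓ 'Y ⊓ 'Z) x y z). Qed.
Let meetKU y x : join x (meet x y) = x.
Proof. exact: (ax HA ('X ⊔ ('X ⊓ 'Y) ≈ 'X) x y x). Qed.
Let joinKI y x : meet x (join x y) = x.
Proof. exact: (ax HA ('X ⊓ ('X ⊔ 'Y) ≈ 'X) x y x). Qed.
Let meetxx x : meet x x = x.
Proof. by rewrite -{2}(meetKU x x) joinKI. Qed.

Let le_refl : reflexive le.
Proof. by move=> x; apply/asboolP. Qed.
Let le_anti : antisymmetric le.
Proof. by move=> x y /andP[/asboolP xy /asboolP yx]; rewrite -xy meetC yx. Qed.
Let le_trans : transitive le.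
Proof.
by move=> y x z /asboolP xy /asboolP yz; apply/asboolP; rewrite -xy -meetA yz.
Qed.

HB.instance Definition _ := gen_eqMixin T.
HB.instance Definition _ := gen_choiceMixin T.
HB.instance Definition _ :=
  Order.Le_isPOrder.Build (Order.Disp tt tt) T le_refl le_anti le_trans.

Let leEmeet x y : (x <= y)%O = (meet x y == x).
Proof. by apply/asboolP/eqP. Qed.

HB.instance Definition _ := Order.POrder_isLattice.Build (Order.Disp tt tt) T
  meetC joinC meetA joinA joinKI meetKU leEmeet.

End Structure.

Local Open Scope order_scope.

Section Distributivity.
Variables (A : algebra) (HA : RDQDStSH1 A).
Notation T := (lattice_of HA).
Implicit Types x y z : T.
Let le0x x : (azero A : T) <= x.
Proof. by apply/asboolP; exact: (ax HA (Zero ⊓ 'X ≈ Zero) x x x). Qed.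
Let lex1 x : x <= (aone A : T).
Proof.
by rewrite leEjoin; apply/eqP; exact: (ax HA ('X ⊔ One ≈ One) x x x).
Qed.

HB.instance Definition _ := Order.hasBottom.Build (Order.Disp tt tt) T le0x.
HB.instance Definition _ := Order.hasTop.Build (Order.Disp tt tt) T lex1.

Lemma meet_imp x y : x `&` imp x y = x `&` y.
Proof. exact: (ax HA ('X ⊓ ('X ⇒ 'Y) ≈ 'X ⊓ 'Y) x y x). Qed.

Lemma meet_imp_meet x y z : x `&` imp y z = x `&` imp (x `&` y) (x `&` z).
Proof.
exact: (ax HA ('X ⊓ ('Y ⇒ 'Z) ≈ 'X ⊓ (('X ⊓ 'Y) ⇒ ('X ⊓ 'Z))) x y z).
Qed.

Lemma impxx x : imp x x = \top.
Proof. exact: (ax HA ('X ⇒ 'X ≈ One) x x x). Qed.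

(* [imp x (x `&` y)] is the relative pseudocomplement, whence distributivity. *)
Lemma le_imp x y z : (z <= imp x (x `&` y)) = (x `&` z <= y).
Proof.
apply/idP/idP => [|xzy].
  move=> /(leI2 (lexx x))/le_trans; apply.
  by rewrite meet_imp leIxr // leIr.
(* Relativized to [z], the two arguments x ∧ z and x ∧ y ∧ z coincide, so the implication becomes
   1. *)
apply/meet_idPl; rewrite meet_imp_meet [x `&` y]meetC [z `&` (_ `&` _)]meetA.
by rewrite [z `&` y `&` x]meetAC [z `&` x]meetC (meet_idPl xzy) impxx meetx1.
Qed.

Let meetUl : @left_distributive T T Order.meet Order.join.
Proof.
move=> x y z; apply/eqP; rewrite eq_le leUx !leI2 ?leUl ?leUr // !andbT.
by rewrite [_ `&` z]meetC -le_imp leUx !le_imp ![z `&` _]meetC leUl leUr.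
Qed.

HB.instance Definition _ := Order.Lattice_Meet_isDistrLattice.Build
  (Order.Disp tt tt) T meetUl.

End Distributivity.

Local Notation "x ^*" := (imp x \bot).

Section Lattice.
Variables (A : algebra) (HA : RDQDStSH1 A).
Notation T := (lattice_of HA).
Implicit Types x y z : T.

Lemma prime0 : prime (\bot : T) = \top.
Proof. exact: (ax HA (Prime Zero ≈ One) (azero A) (azero A) (azero A)). Qed.
Lemma prime1 : prime (\top : T) = \bot.
Proof. exact: (ax HA (Prime One ≈ Zero) (azero A) (azero A) (azero A)). Qed.
Lemma primeI x y : prime (x `&` y) = prime x `|` prime y.
Proof. exact: (ax HA (Prime ('X ⊓ 'Y) ≈ Prime 'X ⊔ Prime 'Y) x y x). Qed.
Lemma prime_primeU x y :
  prime (prime (x `|` y)) = prime (prime x) `|` prime (prime y).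
Proof.
exact: (ax HA (Prime (Prime ('X ⊔ 'Y)) ≈ Prime (Prime 'X) ⊔ Prime (Prime 'Y)) x y x).
Qed.
Lemma prime_prime_le x : prime (prime x) <= x.
Proof. by apply/asboolP; exact: (ax HA (Prime (Prime 'X) ≼ 'X) x x x). Qed.

Lemma level1 x : x `&` (prime x)^* <= (prime (prime x)^*)^*.
Proof. by apply/asboolP; exact: (ax HA level1_id x x x). Qed.
Lemma stone x : x^* `|` x^*^* = \top.
Proof. exact: (ax HA Stone_id x x x). Qed.
Lemma regular x y : x `&` prime (prime x)^* <= y `|` y^*.
Proof. by apply/asboolP; exact: (ax HA regular_id x y x). Qed.

Lemma le_star x y : (y <= x^*) = (x `&` y == \bot).
Proof. by rewrite -{1}(meetx0 x) le_imp lex0. Qed.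

Lemma meetx_star x : x `&` x^* = \bot.
Proof. by apply/eqP; rewrite -le_star. Qed.

Lemma star0 : (\bot : T)^* = \top.
Proof. exact: impxx. Qed.

Lemma star_eq1 x : (x^* == \top) = (x == \bot).
Proof. by rewrite -le1x le_star meetx1. Qed.

Lemma imp1x x : imp \top x = x.
Proof. by rewrite -[LHS]meet1x meet_imp meet1x. Qed.

Lemma prime_anti x y : x <= y -> prime y <= prime x.
Proof. by move=> /meet_idPl <-; rewrite primeI leUr. Qed.

Lemma prime_eq0 x : prime x = \bot -> x = \top.
Proof.
move=> x0; apply/eqP; rewrite -le1x -prime0 -x0; exact: prime_prime_le.
Qed.

Definition central x := x `&` prime x = \bot.

Lemma central1 : central (\top : T).
Proof. by rewrite /central prime1 meetx0. Qed.

Lemma centralI x y : central x -> central y -> central (x `&` y).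
Proof.
rewrite /central => cx cy.
by rewrite primeI meetUr meetAC cx meet0x -meetA cy meetx0 joinxx.
Qed.

Lemma central_prime x : central x -> central (prime x).
Proof.
rewrite /central => cx; apply/eqP; rewrite -lex0 -cx [x `&` _]meetC.
by rewrite leI2 // prime_prime_le.
Qed.

(** 1 = 0' = (x ∧ x')' = x' ∨ x'' ≤ x' ∨ x. *)
Lemma central_joinx_prime x : central x -> x `|` prime x = \top.
Proof.
move=> cx; apply/eqP; rewrite -le1x -prime0 -cx primeI joinC leUx leUr.
by rewrite lexU2 // prime_prime_le.
Qed.

(** [primeI] writes the dual of a meet as a join; in [prime (delta x)] the factor [(prime x)^*]
    kills the joinand [prime x], and level 1 kills the other. *)
Definition delta x := x `&` (prime x)^*.

Lemma central_delta x : central (delta x).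
Proof.
rewrite /central; apply/eqP; rewrite -lex0 {2}/delta primeI meetUr leUx !lex0.
apply/andP; split; first by rewrite /delta -meetA [_^* `&` _]meetC meetx_star meetx0.
by rewrite meetC -le_star level1.
Qed.

End Lattice.

(** * Simple quotients *)

(** The second clause says that [delta] vanishes off 1. Raw operations are used because the
    quotients are not yet known to lie in the variety. *)
Definition simple_like (B : algebra) : Prop :=
  azero B <> aone B /\ forall x : B, x <> aone B ->
    ameet x (aimp (aprime x) (azero B)) = azero B.

Section Quotients.
Variables (A : algebra) (HA : RDQDStSH1 A).
Notation T := (lattice_of HA).
Implicit Types (x y z u c : T) (F S : set T).

Definition central_ultrafilter F : Prop :=
  [/\ forall x, F x -> central x, forall x y, F x -> F y -> F (x `&` y),
      ~ F \bot & forall x, central x -> F x \/ F (prime x)].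

Lemma central_ultrafilter_exists c : central c -> c <> \bot ->
  exists2 F, central_ultrafilter F & F c.
Proof.
move=> cc c0.
(* Zorn's lemma is applied to meet-closed sets of central elements, each meeting [c] in a nonzero
   element. *)
pose P S := [/\ forall x, S x -> central x,
  forall x y, S x -> S y -> S (x `&` y) & forall x, S x -> x `&` c <> \bot].
have [|F [[FN FI Fc] Fmax]] := @Zorn_bigcup T P.
  move=> C CP Ctot; split=> [x [S CS Sx]|x y [S CS Sx] [S' CS' Sy]|x [S CS Sx]].
  - by have [+ _ _] := CP _ CS; apply.
  - have [SS'|S'S] := Ctot _ _ CS CS'.
      by exists S' => //; have [_ + _] := CP _ CS'; apply=> //; apply: SS'.
    by exists S => //; have [_ + _] := CP _ CS; apply=> //; apply: S'S.
  - by have [_ _ +] := CP _ CS; apply.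
have maxF S : P S -> (F `<=` S)%classic -> (S `<=` F)%classic.
  move=> PS FS; apply: contrapT => SF; exact: (Fmax S (conj FS SF) PS).
have F1 : F \top.
  apply: (maxF (fun x => F x \/ x = \top)); [|by left|by right].
  split=> [x [/FN//|->]|x y [Fx|->] [Fy|->]|x [/Fc//|->]].
  - exact: central1.
  - by left; apply: FI.
  - by left; rewrite meetx1.
  - by left; rewrite meet1x.
  - by right; rewrite meet1x.
  - by rewrite meet1x.
have ext x : central x -> F x \/ exists2 s, F s & s `&` x `&` c = \bot.
  move=> cx; have [[s Fs sx]|nex] := pselect (exists2 s, F s & s `&` x `&` c = \bot).
    by right; exists s.
  (* If no [s] in [F] excludes [x], adjoining all s ∧ x preserves [P], so maximality puts [x] in
     [F]. *)
  left; apply: (maxF (fun z => F z \/ exists2 s, F s & z = s `&` x)).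
  - split=> [z [/FN//|[s Fs ->]]|z t [Fz|[s Fs ->]] [Ft|[r Fr ->]]|z [/Fc//|[s Fs ->]]].
    + by apply: centralI => //; apply: FN.
    + by left; apply: FI.
    + by right; exists (z `&` r); [apply: FI | rewrite meetA].
    + by right; exists (s `&` t); [apply: FI | rewrite meetAC].
    + by right; exists (s `&` r); [apply: FI | rewrite meetACA meetxx].
    + by move=> sx; apply: nex; exists s.
  - by left.
  - by right; exists \top; rewrite ?meet1x.
have ult x : central x -> F x \/ F (prime x).
  move=> cx; have [|[s Fs sx]] := ext x cx; first by left.
  have [|[r Fr rx]] := ext _ (central_prime cx); first by right.
  case: (Fc (s `&` r)); first exact: FI.
  (* From s ∧ x ∧ c = 0 = r ∧ x' ∧ c and x ∨ x' = 1 follows s ∧ r ∧ c = 0. *)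
  rewrite -[s `&` r]meetx1 -(central_joinx_prime cx) meetUr meetUl.
  rewrite [s `&` r `&` x]meetAC [_ `&` r `&` c]meetAC sx meet0x join0x.
  by rewrite -!meetA (meetA r) rx meetx0.
exists F; first by split=> // /Fc; rewrite meet0x.
by have [//|/Fc] := ult c cc; rewrite meetC cc.
Qed.

Definition sim F x y : Prop := exists2 u, F u & x `&` u = y `&` u.

Section Ultrafilter.
Variables (F : set T) (FU : central_ultrafilter F) (c : T) (Fc : F c).

Let FI x y : F x -> F y -> F (x `&` y).
Proof. by have [_ + _ _] := FU; apply. Qed.
Let FN x : F x -> central x.
Proof. by have [+ _ _ _] := FU; apply. Qed.

Lemma meet_weaken x y u w : x `&` u = y `&` u -> x `&` (u `&` w) = y `&` (u `&` w).
Proof. by rewrite !meetA => ->. Qed.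

Let sim2 x x' y y' : sim F x x' -> sim F y y' ->
  exists2 u, F u & x `&` u = x' `&` u /\ y `&` u = y' `&` u.
Proof.
move=> [u Fu xu] [w Fw yw]; exists (u `&` w); first exact: FI.
by split; [|rewrite [u `&` w]meetC]; apply: meet_weaken.
Qed.

Lemma sim_refl x : sim F x x. Proof. by exists c. Qed.

Lemma sim_sym x y : sim F x y -> sim F y x.
Proof. by move=> [u Fu xy]; exists u. Qed.

Lemma sim_trans x y z : sim F x y -> sim F y z -> sim F x z.
Proof.
move=> xy yz; have [u Fu [xu yu]] := sim2 xy yz.
by exists u => //; rewrite xu.
Qed.

Lemma sim_join x x' y y' : sim F x x' -> sim F y y' -> sim F (x `|` y) (x' `|` y').
Proof.
move=> xx' yy'; have [u Fu [xu yu]] := sim2 xx' yy'.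
by exists u => //; rewrite !meetUl xu yu.
Qed.

Lemma sim_meet x x' y y' : sim F x x' -> sim F y y' -> sim F (x `&` y) (x' `&` y').
Proof.
move=> xx' yy'; have [u Fu [xu yu]] := sim2 xx' yy'; exists u => //.
by rewrite meetAC xu meetAC -meetA yu meetA.
Qed.

Lemma sim_imp x x' y y' : sim F x x' -> sim F y y' -> sim F (imp x y) (imp x' y').
Proof.
move=> xx' yy'; have [u Fu [xu yu]] := sim2 xx' yy'; exists u => //.
rewrite [LHS]meetC [RHS]meetC meet_imp_meet [RHS]meet_imp_meet.
by rewrite ![u `&` x]meetC ![u `&` y]meetC xu yu ![_ `&` u]meetC.
Qed.

(** As u ∧ u' = 0, x' ∧ u = (x' ∨ u') ∧ u = (x ∧ u)' ∧ u depends only on x ∧ u. *)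
Lemma central_prime_meet x y u :
  central u -> x `&` u = y `&` u -> prime x `&` u = prime y `&` u.
Proof.
move=> cu xy; have pu z : prime z `&` u = prime (z `&` u) `&` u.
  by rewrite primeI meetUl [prime u `&` u]meetC cu joinx0.
by rewrite pu xy -pu.
Qed.

Lemma sim_prime x x' : sim F x x' -> sim F (prime x) (prime x').
Proof.
by move=> [u Fu xu]; exists u => //; apply: central_prime_meet => //; apply: FN.
Qed.

Definition ultraquotient : algebra := @quotient A (sim F).

Let pi : A -> ultraquotient := proj (sim F).

Lemma pi_eq x y : pi x = pi y <-> sim F x y.
Proof. apply: proj_eq; [exact: sim_refl|exact: sim_sym|exact: sim_trans]. Qed.

Lemma pi_hom : homomorphism pi.
Proof.
apply: proj_hom; [exact: sim_refl|exact: sim_sym|exact: sim_trans|exact: sim_join|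
  exact: sim_meet|exact: sim_imp|exact: sim_prime].
Qed.

Lemma pi_surj : surjection pi. Proof. exact: proj_surj. Qed.

(** The ultrafilter decides [delta x]: if it contains [delta x], then [x], lying above it, becomes
    1; if it contains the complement, [delta x] becomes 0. *)
Lemma ultraquotient_simple : simple_like ultraquotient.
Proof.
have [_ _ F0 Fult] := FU; split.
  move=> /pi_eq [u Fu]; rewrite [X in X = _]meet0x [X in _ = X]meet1x => u0.
  by apply: F0; rewrite u0.
move=> q; have [x <-] := pi_surj q => x1.
have [_ hI himp hp [h0 h1]] := pi_hom.
rewrite -[azero _]h0 -hp -himp -hI; apply/pi_eq.
have [Fd|Fd] := Fult _ (central_delta x).
  case: x1; rewrite -h1; apply/pi_eq; exists (delta x) => //.
  by rewrite [RHS]meet1x /delta meetA meetxx.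
by exists (prime (delta x)) => //; rewrite [RHS]meet0x; apply: central_delta.
Qed.

End Ultrafilter.

Lemma biimp_eq1 x y : imp x y `&` imp y x = \top -> x = y.
Proof.
move=> xy; have /andP[/eqP x1 /eqP y1] : (imp x y == \top) && (imp y x == \top).
  by rewrite -!le1x -lexI xy.
by rewrite -[LHS]meetx1 -x1 meet_imp meetC -meet_imp y1 meetx1.
Qed.

Lemma separating_quotient x y : x <> y ->
  exists (B : algebra) (h : A -> B),
    [/\ homomorphism h, surjection h, simple_like B & h x <> h y].
Proof.
move=> xy; pose d := imp x y `&` imp y x.
have cd := central_delta d.
(* [F] is chosen to contain the complement of [delta d]; were that 0, then [delta d] and [d] would
   be 1, so x = y. *)
have [|F FU Fd] := central_ultrafilter_exists (central_prime cd).
  move=> /prime_eq0 d1; apply/xy/biimp_eq1/eqP; rewrite -le1x -d1; exact: leIl.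
exists (ultraquotient F), (proj (sim F)); split.
- exact: pi_hom Fd.
- exact: pi_surj.
- exact: ultraquotient_simple Fd.
- move=> /(pi_eq FU Fd)[u Fu xyu].
  have [FN FI F0 _] := FU; apply: F0.
  have ud : u <= d.
    rewrite lexI; apply/andP; split; apply/meet_idPl; rewrite meet_imp_meet;
      by rewrite ![u `&` x]meetC ![u `&` y]meetC xyu impxx meetx1.
  (* Since u ≤ d, d' ≤ u' is disjoint from the central [u]; so [u] lies below [delta d] and meets
     its complement in 0, which would put 0 in [F]. *)
  have ude : u <= delta d.
    rewrite lexI ud le_star -lex0 -(FN _ Fu) meetC leI2 //; exact: prime_anti.
  have -> : \bot = u `&` prime (delta d); last exact: FI.
  by apply/esym/eqP; rewrite -lex0 -cd leI2.
Qed.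

End Quotients.

(** * Classification of the simple quotients *)

Section Simple.
Variables (B : algebra) (HB : RDQDStSH1 B) (Bs : simple_like B).
Notation T := (lattice_of HB).
Implicit Types x y a b s : T.

Lemma simple_delta x : x <> \top -> x `&` (prime x)^* = \bot.
Proof. exact: (proj2 Bs x). Qed.

Lemma star_anti x y : x <= y -> y^* <= x^*.
Proof. by move/(fun h => leI2 h (lexx y^*)); rewrite meetx_star lex0 le_star. Qed.

Lemma dense_le a b : a^* = \bot -> a <= b -> b^* = \bot.
Proof. by move=> a0 /star_anti; rewrite a0 lex0 => /eqP. Qed.

Lemma dense_joinx_star y : (y `|` y^*)^* = \bot.
Proof.
apply/eqP; rewrite -lex0 -[leRHS](meetx_star y^*) lexI !star_anti ?leUl ?leUr //.
Qed.

Section Dense.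
Variables (a : T) (a1 : a <> \top) (a0 : a^* = \bot).

(** [delta a] is 0, so [(prime a)^*] lies below [a^*]. *)
Lemma dense_prime : (prime a)^* = \bot.
Proof. by apply/eqP; rewrite -lex0 -[leRHS]a0 le_star simple_delta. Qed.

(** Density of [prime a] makes a^+ equal to 1, so regularity bounds [a] itself. *)
Lemma dense_least y : a <= y `|` y^*.
Proof. by have := regular a y; rewrite dense_prime prime0 meetx1. Qed.

End Dense.

(** * Simple algebras with a dense element other than 1 *)

Section Chain.
Variables (a : T) (a1 : a <> \top) (a0 : a^* = \bot).

Lemma dense_eq b : b^* = \bot -> b = a \/ b = \top.
Proof.
move=> b0; have [|b1] := pselect (b = \top); [by right|left].
apply/le_anti; have := dense_least a1 a0 b; have := dense_least b1 b0 a.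
by rewrite a0 b0 !joinx0 => -> ->.
Qed.

(** The map '' preserves joins and lies below the identity; applied to a ∨ s = 1 and s ∨ s^* = 1 it
    forces [s] to be 0 or 1. *)
Lemma complemented_absurd s :
  s `|` s^* = \top -> a `|` s = \top -> s <> \top -> s^* <> \top -> False.
Proof.
move=> ss as1 s1 s'1.
have sa : s^* <= a.
  rewrite -[s^*]meetx1 -as1 meetUr [s^* `&` s]meetC meetx_star joinx0; exact: leIr.
have top_le : prime (prime s) = \top -> s = \top.
  by move=> E; apply/eqP; rewrite -le1x -E prime_prime_le.
have := prime_primeU a s; rewrite as1 prime1 prime0 => E.
have [a'|a'] := dense_eq (dense_prime a1 a0); last first.
  by apply/s1/top_le; rewrite E a' prime1 join0x.
have ple : a <= prime s^* by rewrite -{1}a'; exact: prime_anti.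
(* The dual of [s^*] is [a] or 1: in the first case a ≤ s^* gives s = 0, in the second s'' = 1. *)
have [s'|s'] := dense_eq (dense_le a0 ple).
  have : a <= s^* by rewrite -{1}a' -s' prime_prime_le.
  rewrite le_star meetC -le_star a0 lex0 => /eqP s0.
  by apply: s'1; rewrite s0 star0.
have := prime_primeU s s^*; rewrite ss prime1 prime0 s' prime1 joinx0 => /esym.
by move/top_le.
Qed.

(** Otherwise [x^*] and [x^*^*] are proper complements by the Stone identity; each must lie below
    [a], so a = 1. *)
Lemma star_chain x : x^* = \bot \/ x^* = \top.
Proof.
have [|x0] := pselect (x^* = \bot); [by left|right].
apply: contrapT => x1; have st := stone x.
have xx1 : x^*^* <> \top.
  by move=> /eqP; rewrite star_eq1 => /eqP.
have xx0 : x^*^*^* <> \top.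
  move=> /eqP; rewrite star_eq1 => /eqP E.
  by apply: x1; rewrite -st E joinx0.
have d s : (a `|` s)^* = \bot by apply: dense_le a0 (leUl _ _).
have [E|] := dense_eq (d x^*); last by move/(complemented_absurd st); apply.
have [E'|] := dense_eq (d x^*^*); last first.
  by move/(complemented_absurd (stone x^*)); apply.
by apply/a1/eqP; rewrite -le1x -st leUx -{1}E -{2}E' !leUr.
Qed.

Lemma chain_cases x : [\/ x = \bot, x = a | x = \top].
Proof.
have [/dense_eq[]|/eqP] := star_chain x; [by constructor 2|by constructor 3|].
by rewrite star_eq1 => /eqP; constructor 1.
Qed.

End Chain.

(** * Simple algebras in which every element is complemented *)

Section Boolean.
Hypothesis compl : forall x : T, x `|` x^* = \top.

(** Splitting [s] along [prime s] and its complement, the second piece is [delta s], which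
    vanishes. *)
Lemma le_prime s : s <> \top -> s <= prime s.
Proof.
move=> s1; rewrite -[leLHS]meetx1 -(compl (prime s)) meetUr simple_delta //.
by rewrite joinx0 leIr.
Qed.

(** s ≤ s' by [le_prime], and s' ≤ s'' ≤ s unless s' = 1. In that case s'' = 0, so the complement of
    [s] has double dual 1, hence is 1, and s = 0. *)
Lemma prime_id s : s <> \bot -> s <> \top -> prime s = s.
Proof.
move=> s0 s1; apply/le_anti; rewrite le_prime // andbT.
apply: le_trans (prime_prime_le s); apply: le_prime => s'.
have := prime_primeU s s^*; rewrite compl prime1 prime0 s' prime1 join0x => E.
by apply/s0/eqP; rewrite -star_eq1 -le1x E prime_prime_le.
Qed.

(** The antitone [prime] fixes both elements, so s ≤ x also gives x ≤ s. *)
Lemma prime_antichain s x :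
  s <> \bot -> s <> \top -> x <> \bot -> x <> \top -> s <= x -> s = x.
Proof.
move=> s0 s1 x0 x1 sx; apply/le_anti; rewrite sx /=.
by rewrite -(prime_id s0 s1) -{1}(prime_id x0 x1) prime_anti.
Qed.

Lemma star_neq0 s : s <> \top -> s^* <> \bot.
Proof. by move=> s1 E; apply: s1; rewrite -(compl s) E joinx0. Qed.

Lemma star_neq1 s : s <> \bot -> s^* <> \top.
Proof. by move=> s0 /eqP; rewrite star_eq1 => /eqP. Qed.

Lemma boolean_cases a x : a <> \bot -> a <> \top ->
  [\/ x = \bot, x = a, x = a^* | x = \top].
Proof.
move=> a0 a1.
have [|x0] := pselect (x = \bot); first by constructor 1.
have [|x1] := pselect (x = \top); first by constructor 4.
have [/eqP|xa0] := pselect (a `&` x = \bot).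
  rewrite -le_star => xa; constructor 3; apply: prime_antichain => //.
    exact: star_neq0.
  exact: star_neq1.
have xa1 : a `&` x <> \top by move=> E; apply/a1/eqP; rewrite -le1x -E leIl.
constructor 2.
rewrite -(prime_antichain xa0 xa1 x0 x1 (leIr _ _)).
exact: prime_antichain (leIl _ _).
Qed.

(** The single value 0 → 1 determines the implication: below [x] it is [y], below [x^*] it is 0 → y,
    which is split again along [y] and [y^*]. *)
Lemma boolean_imp x y :
  imp x y = (x `&` y) `|` (x^* `&` y^*) `|` (x^* `&` y `&` imp \bot \top).
Proof.
have impx : x^* `&` imp x y = x^* `&` imp \bot y.
  by rewrite meet_imp_meet [RHS]meet_imp_meet meetx0 [x^* `&` x]meetC meetx_star.
have imp0y : imp \bot y = y^* `|` (y `&` imp \bot \top).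
  rewrite [y `&` _]meet_imp_meet meetx0 meetx1 -[y^*]meetx1 -(impxx \bot).
  have <- : y^* `&` imp \bot y = y^* `&` imp \bot \bot.
    by rewrite meet_imp_meet meetx0 [y^* `&` y]meetC meetx_star.
  by rewrite -meetUl joinC compl meet1x.
rewrite -[LHS]meet1x -[X in X `&` imp x y](compl x) meetUl meet_imp impx imp0y.
by rewrite meetUr meetA joinA.
Qed.

End Boolean.

End Simple.

(** * The twenty-five simple algebras *)

(** [c] is the value of 0 → 1. *)
Definition two_imp (c x y : bool) : bool := if x then y else y ==> c.

Definition two_algebra (c : bool) : algebra :=
  Algebra orb andb (two_imp c) negb false true.

Variant chain3 := C0 | Ca | C1.

Definition chain_join (x y : chain3) : chain3 :=
  match x, y with
  | C0, z | z, C0 => z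
  | Ca, Ca => Ca
  | _, _ => C1
  end.

Definition chain_meet (x y : chain3) : chain3 :=
  match x, y with
  | C1, z | z, C1 => z
  | Ca, Ca => Ca
  | _, _ => C0
  end.

(* [w] decides whether [a -> 1] is [1] or [a]; [u] is [None] when
   [0 -> 1 = 0 -> a = 0], and otherwise its components decide whether [0 -> 1]
   and [0 -> a] are [1] or [a]. *)
Definition chain_imp (w : bool) (u : option (bool * bool)) (x y : chain3) :=
  match x, y with
  | C0, C0 | Ca, Ca => C1
  | C1, z => z
  | Ca, C0 => C0
  | Ca, C1 => if w then C1 else Ca
  | C0, C1 => if u is Some (t, _) then if t then C1 else Ca else C0
  | C0, Ca => if u is Some (_, t) then if t then C1 else Ca else C0
  end.

Definition chain_prime (d : bool) (x : chain3) : chain3 :=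
  match x with C0 => C1 | Ca => if d then Ca else C1 | C1 => C0 end.

Definition chain_algebra d w u : algebra :=
  Algebra chain_join chain_meet (chain_imp w u) (chain_prime d) C0 C1.

(* [0 -> 1] is [0] for [None], the atom [(true, false)] for [Some false] and
   [1] for [Some true]. *)
Definition four_algebra (u : option bool) : algebra :=
  Algebra (fun x y : bool * bool => (x.1 || y.1, x.2 || y.2))
    (fun x y => (x.1 && y.1, x.2 && y.2))
    (fun x y => (two_imp (u != None) x.1 y.1, two_imp (u == Some true) x.2 y.2))
    (fun x => (~~ x.2, ~~ x.1)) (false, false) (true, true).

Variant simple_index :=
  | Two of bool
  | Chain of bool & bool & option (bool * bool)
  | Four of option bool.

Definition simple_algebra (i : simple_index) : algebra :=
  match i with
  | Two c => two_algebra c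
  | Chain d w u => chain_algebra d w u
  | Four u => four_algebra u
  end.

Ltac case_index := case=> [[]|[] [] [[[] []]|]|[[]|]].

Lemma simple_algebra_RDQDStSH1 i : RDQDStSH1 (simple_algebra i).
Proof.
(* The variety has 19 axioms in at most three variables; each is checked on all values. *)
move=> e; do 19! [case; [move=> <-; case: i => [c|d w u|u] v; rewrite /=;
  move: (v 0) (v 1) (v 2) => {v};
  [ by case=> [] [] []; case: c
  | case=> [] [] []; rewrite //=;
    by case: u => [[[] []]|]; rewrite //=; case: w; rewrite //=; case: d
  | case=> [[] []] [[] []] [[] []]; rewrite //=; by case: u => [[]|]] |]].
by [].
Qed.

(** * Matching simple quotients with the list *)

Section Classification.
Variables (B : algebra) (HB : RDQDStSH1 B) (Bs : simple_like B).
Notation T := (lattice_of HB).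
Implicit Types x y a : T.

Let ne01 : (\bot : T) <> \top.
Proof. exact: (proj1 Bs). Qed.

Lemma chain_classification a : a <> \top -> a^* = \bot ->
  exists i (g : simple_algebra i -> B),
    [/\ homomorphism g, injective g & surjection g].
Proof.
move=> a1 a0.
have an0 : a <> \bot by move=> E; apply: ne01; rewrite -a0 E star0.
have cases x := chain_cases Bs a1 a0 x.
(* Below the dense [a], 0 → 1 and 0 → a agree, so both are 0 or neither is; hence [u] is an option
   of a pair. *)
have meet_a01 : a `&` imp \bot \top = a `&` imp \bot a.
  by rewrite meet_imp_meet meetx0 meetx1.
have [d ad] : exists d : bool, prime a = if d then a else \top.
  have [->|->] := dense_eq Bs a1 a0 (dense_prime Bs a1 a0).
    by exists true.
  by exists false.
have [w aw] : exists w : bool, imp a \top = if w then \top else a.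
  have := meet_imp a (\top : T); rewrite meetx1.
  case: (cases (imp a \top)) => -> E; [|by exists false|by exists true].
  by case: an0; rewrite -E meetx0.
have nontriv (b : T) : [\/ b = \bot, b = a | b = \top] -> a `&` b <> \bot ->
    exists t : bool, b = if t then \top else a.
  by case=> ->; rewrite ?meetx0 // => _; [exists false | exists true].
have [u [u1 ua]] : exists u : option (bool * bool),
    imp \bot \top = (if u is Some (t, _) then if t then \top else a else \bot)
    /\ imp \bot a = (if u is Some (_, t) then if t then \top else a else \bot).
  have [E|E] := pselect (a `&` imp \bot \top = \bot).
    have z (b : T) : a `&` b = \bot -> b = \bot.
      by move=> /eqP; rewrite -le_star a0 lex0 => /eqP.
    by exists None; split; apply: z => //; rewrite -meet_a01.
  have [t Et] := nontriv _ (cases _) E.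
  have [|t' Et'] := nontriv _ (cases (imp \bot a)); first by rewrite -meet_a01.
  by exists (Some (t, t')).
pose g (x : chain3) : T := match x with C0 => \bot | Ca => a | C1 => \top end.
exists (Chain d w u), g; split.
- split=> //.
  + move=> x y; transitivity (g x `|` g y) => //; rewrite /g.
    by case: x y => [] [] /=; rewrite ?(join0x, joinx0, join1x, joinx1, joinxx).
  + move=> x y; transitivity (g x `&` g y) => //; rewrite /g.
    by case: x y => [] [] /=; rewrite ?(meet0x, meetx0, meet1x, meetx1, meetxx).
  + move=> x y; transitivity (imp (g x) (g y)) => //; rewrite /g.
    by case: x y => [] [] /=; rewrite ?(impxx, imp1x, a0, aw, u1, ua) //;
      case: (w) (u) => [] [[[] []]|].
  + move=> x; transitivity (prime (g x)) => //; rewrite /g.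
    by case: x => /=; rewrite ?(prime0, prime1, ad) //; case: (d).
- by move=> [] [] //= /esym //.
- by move=> x; case: (cases x) => ->; [exists C0 | exists Ca | exists C1].
Qed.

Lemma two_classification : (forall x : T, x = \bot \/ x = \top) ->
  exists i (g : simple_algebra i -> B),
    [/\ homomorphism g, injective g & surjection g].
Proof.
move=> cases.
have [c E] : exists c : bool, imp \bot \top = if c then \top : T else \bot.
  by case: (cases (imp \bot \top)) => ->; [exists false | exists true].
pose g (x : bool) : T := if x then \top else \bot.
exists (Two c), g; split.
- split=> //.
  + move=> x y; transitivity (g x `|` g y) => //; rewrite /g.
    by case: x y => [] [] /=; rewrite ?(join0x, joinx0, join1x, joinx1, joinxx).
  + move=> x y; transitivity (g x `&` g y) => //; rewrite /g.
    by case: x y => [] [] /=; rewrite ?(meet0x, meetx0, meet1x, meetx1, meetxx).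
  + move=> x y; transitivity (imp (g x) (g y)) => //; rewrite /g.
    by case: x y => [] [] /=; rewrite ?(impxx, imp1x, E).
  + move=> x; transitivity (prime (g x)) => //; rewrite /g.
    by case: x; rewrite /= ?(prime0, prime1).
- by move=> [] [] //= /esym //.
- by move=> x; case: (cases x) => ->; [exists false | exists true].
Qed.

Section Boolean.
Hypothesis compl : forall x : T, x `|` x^* = \top.

Lemma four_classification a u : a <> \bot -> a <> \top ->
    imp \bot \top = (if u is Some t then if t then \top else a else \bot) ->
  exists i (g : simple_algebra i -> B),
    [/\ homomorphism g, injective g & surjection g].
Proof.
move=> a0 a1 E.
pose b : T := a^*.
have b0 : b <> \bot := star_neq0 compl a1.
have b1 : b <> \top := star_neq1 a0.
have ab0 : a `&` b = \bot by exact: meetx_star.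
have ba0 : b `&` a = \bot by rewrite meetC.
have ab1 : a `|` b = \top := compl a.
have ba1 : b `|` a = \top by rewrite joinC.
have nab : a <> b by move=> ab; apply: a0; rewrite -ab0 -ab meetxx.
have bs : b^* = a.
  have le_ab : a <= b^* by rewrite le_star ba0.
  apply/le_anti; rewrite le_ab andbT.
  by rewrite -[b^*]meetx1 -ab1 meetUr [_ `&` b]meetC meetx_star joinx0 leIr.
have as_ : a^* = b by [].
have pa := prime_id Bs compl a0 a1; have pb := prime_id Bs compl b0 b1.
have star1 : (\top : T)^* = \bot by rewrite imp1x.
pose g (x : bool * bool) : T :=
  match x with
  | (false, false) => \bot | (true, false) => a
  | (false, true) => b | (true, true) => \top
  end.
exists (Four u), g; split.
- split=> //.
  + move=> x y; transitivity (g x `|` g y) => //; rewrite /g.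
    by case: x y => [[] []] [[] []] /=;
      rewrite ?(join0x, joinx0, join1x, joinx1, joinxx, ab1, ba1).
  + move=> x y; transitivity (g x `&` g y) => //; rewrite /g.
    by case: x y => [[] []] [[] []] /=;
      rewrite ?(meet0x, meetx0, meet1x, meetx1, meetxx, ab0, ba0).
  + move=> x y; transitivity (imp (g x) (g y)) => //; rewrite /g.
    rewrite [RHS](boolean_imp compl) E.
    case: x y => [[] []] [[] []]; case: (u) => [[]|] /=;
    by rewrite ?(star0, star1, as_, bs) ?(meet0x, meetx0, meet1x, meetx1, meetxx,
      ab0, ba0) ?(join0x, joinx0, join1x, joinx1, joinxx, ab1, ba1).
  + move=> x; transitivity (prime (g x)) => //; rewrite /g.
    by case: x => [[] []]; rewrite /= ?(prime0, prime1, pa, pb).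
- by move=> [[] []] [[] []] //= /esym //.
- move=> x; case: (boolean_cases Bs compl x a0 a1) => ->;
  by [exists (false, false) | exists (true, false) |
      exists (false, true) | exists (true, true)].
Qed.

Lemma boolean_classification :
  exists i (g : simple_algebra i -> B),
    [/\ homomorphism g, injective g & surjection g].
Proof.
have [ex|nex] := pselect (exists a : T, a <> \bot /\ a <> \top); last first.
  apply: two_classification => x; have [|x0] := pselect (x = \bot); [by left|right].
  by apply: contrapT => x1; apply: nex; exists x.
have [a [a0 a1]] := ex.
case: (boolean_cases Bs compl (imp \bot \top) a0 a1) => E.
- exact: (@four_classification a None).
- exact: (@four_classification a (Some false)).
(* Here 0 → 1 is the other atom, so [a] and [a^*] exchange roles. *)
- apply: (@four_classification a^* (Some false)) => //.
    exact: star_neq0.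
  exact: star_neq1.
- exact: (@four_classification a (Some true)).
Qed.

End Boolean.

Lemma simple_classification :
  exists i (g : simple_algebra i -> B),
    [/\ homomorphism g, injective g & surjection g].
Proof.
have [[a [a1 a0]]|nex] := pselect (exists a : T, a <> \top /\ a^* = \bot).
  exact: chain_classification a1 a0.
(* Every x ∨ x^* is dense, hence equal to 1 when no other dense element exists. *)
apply: boolean_classification => x; apply: contrapT => x1; apply: nex.
by exists (x `|` x^*); rewrite dense_joinx_star.
Qed.

End Classification.

(** The refuting algebra is isomorphic to a quotient of [A], so it inherits the identities of [A];
    this lets simple members determine a subvariety. *)
Lemma simple_refutation (A : algebra) (e : identity) :
    RDQDStSH1 A -> ~ satisfies A e ->
  exists i, ~ satisfies (simple_algebra i) e /\
    forall e', satisfies A e' -> satisfies (simple_algebra i) e'.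
Proof.
move=> HA /existsNP[v ve].
have [B [h [hh hs Bs hv]]] := @separating_quotient _ HA _ _ ve.
have HB : RDQDStSH1 B by move=> e' /HA; apply: satisfies_surj hs.
have [i [g [gh gi gs]]] := simple_classification HB Bs.
exists i; split=> [/(satisfies_surj gh gs)|e' Ae'].
  by move/(_ (h \o v)); rewrite -!eval_hom.
by apply: satisfies_inj gh gi _; apply: satisfies_surj hs Ae'.
Qed.

(** * Splitting identities *)

Definition delta_term (t : term) : term := Meet t (star (Prime t)).
Definition biimp (s t : term) : term := Meet (Imp s t) (Imp t s).

(* In a simple algebra the conjunction takes the value [1] exactly when ['X]
   satisfies the defining relations of the generator of the [i]-th algebra. *)
Definition diagram (i : simple_index) : term :=
  match i with
  | Two c => biimp (Zero ⇒ One) (if c then One else Zero)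
  | Chain d w u =>
      biimp (star 'X) Zero ⊓ biimp (delta_term 'X) Zero
      ⊓ biimp (Prime 'X) (if d then 'X else One)
      ⊓ biimp ('X ⇒ One) (if w then One else 'X)
      ⊓ biimp (Zero ⇒ One)
          (if u is Some (t, _) then if t then One else 'X else Zero)
      ⊓ biimp (Zero ⇒ 'X)
          (if u is Some (_, t) then if t then One else 'X else Zero)
  | Four u =>
      biimp (Prime 'X) 'X ⊓ ('X ⊔ star 'X)
      ⊓ biimp (Zero ⇒ One)
          (if u is Some t then if t then One else 'X else Zero)
  end%term.

(** In a simple algebra [delta_term] sends 1 to 1 and all else to 0, so the identity fails exactly
    when the diagram takes the value 1. *)
Definition splitting (i : simple_index) : identity :=
  delta_term (diagram i) ≈ Zero.

(* [Some c] when [{0, 1}] is a subalgebra, isomorphic to [two_algebra c]. *)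
Definition bottom_of (i : simple_index) : option bool :=
  match i with
  | Two c => Some c
  | Chain _ _ None | Four None => Some false
  | Chain _ _ (Some (true, _)) | Four (Some true) => Some true
  | Chain _ _ (Some (false, _)) | Four (Some false) => None
  end.

Lemma satisfies_bottom i c e : bottom_of i = Some c ->
  satisfies (simple_algebra i) e -> satisfies (two_algebra c) e.
Proof.
move=> ic; pose h (x : bool) : simple_algebra i :=
  if x then aone (simple_algebra i) else azero (simple_algebra i).
apply: (@satisfies_inj (two_algebra c) (simple_algebra i) h).
  rewrite /h {h}; move: i ic.
  by case_index => // -[<-]; split=> // [] [] // [].
by move=> [] []; rewrite /h {h}; move: i ic; case_index.
Qed.

Lemma splitting_self i : ~ satisfies (simple_algebra i) (splitting i).
Proof.
case: i => [c|d w u|u]; rewrite /satisfies.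
- by move/(_ (fun=> true)); case: c.
- by move/(_ (fun=> Ca)); case: d w u => [] [] [[[] []]|].
- by move/(_ (fun=> (true, false))); case: u => [[]|].
Qed.

(** The exception arises because the diagram of [Two c] only records 0 → 1, and so is also 1 in the
    larger algebras containing [Two c]. All pairs are checked. *)
Lemma splitting_other i j : satisfies (simple_algebra j) (splitting i) \/
  (i = j \/ exists2 c, i = Two c & bottom_of j = Some c).
Proof.
move: i j; case_index; case_index;
  (try by right; left); (try by right; right; eexists);
  left => v; rewrite /=; by move: (v 0); do ?[by [] | case].
Qed.

(** * The lattice of subvarieties *)

(** If an identity of [L] failed in some [A] in [K], it would fail in a simple algebra satisfying
    all identities of [A], hence lying in [K]. *)
Lemma subvariety_le_simple (K L : subvariety RDQDStSH1) :
  (K <= L) <-> (forall i, K (simple_algebra i) -> L (simple_algebra i)).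
Proof.
split=> [/asboolP KL i|KL]; first exact: KL.
apply/asboolP => A KA.
have [EK hK] := subvariety_is_variety K; have [EL hL] := subvariety_is_variety L.
apply/hL => e Le; apply: contrapT => nAe.
have [i [nie ie]] := simple_refutation (subvariety_sub KA) nAe.
apply: nie; have /KL/hL : K (simple_algebra i); last exact.
by apply/hK => e' Ke'; apply: ie; move: e' Ke'; apply/hK.
Qed.

Lemma subvariety_bottom (K : subvariety RDQDStSH1) i c :
  bottom_of i = Some c -> K (simple_algebra i) -> K (two_algebra c).
Proof.
have [EK hK] := subvariety_is_variety K => ic /hK Ki; apply/hK => e Ke.
exact: satisfies_bottom ic (Ki e Ke).
Qed.

(** The witness is defined by all identities valid on [D]. For [i] outside [D], [splitting i] is
    among them, downward closure ruling out the exceptional case. *)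
Lemma subvariety_of_downset (D : simple_index -> Prop) :
  (forall i c, bottom_of i = Some c -> D i -> D (Two c)) ->
  exists K : subvariety RDQDStSH1, forall i, K (simple_algebra i) <-> D i.
Proof.
move=> Ddown.
pose E e := forall i, D i -> satisfies (simple_algebra i) e.
have EV A : models E A -> RDQDStSH1 A.
  by move=> EA e Ve; apply: EA => i _; exact: simple_algebra_RDQDStSH1.
exists (Subvariety (models_is_variety E) EV) => i; split=> [Ei|Di e]; last exact.
apply: contrapT => nDi; apply: (@splitting_self i); apply: Ei => j Dj.
have [//|[E'|[c E' jc]]] := splitting_other i j; case: nDi; rewrite E' //.
exact: Ddown jc Dj.
Qed.

Lemma mono_lattice_isomorphic d (L : latticeType d) d' (M : latticeType d')
    (f : L -> M) :
  {mono f : x y / x <= y} -> (forall y, exists x, f x = y) ->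
  lattice_isomorphic L M.
Proof.
move=> fmono /boolp.choice[g gK].
have fK : cancel f g.
  by move=> x; apply/le_anti; rewrite -!fmono !gK lexx.
have fle : {homo f : x y / x <= y} by move=> x y; rewrite fmono.
have fI : {morph f : x y / x `&` y}.
  move=> x y; apply/le_anti; rewrite lexI !fmono leIl leIr /=.
  by rewrite -[f x `&` _]gK fmono lexI -!fmono gK leIl leIr.
have fU : {morph f : x y / x `|` y}.
  move=> x y; apply/le_anti; rewrite leUx !fmono leUl leUr andbT.
  by rewrite -[f x `|` _]gK fmono leUx -!fmono gK leUl leUr.
pose F : {lmorphism L -> M} := HB.pack f (Order.isOrderMorphism.Build d L d' M f fle)
  (Order.isMeetLatticeMorphism.Build d L d' M f fI)
  (Order.isJoinLatticeMorphism.Build d L d' M f fU).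
by exists F; exists g.
Qed.

(* [nontwo b] enumerates the [i] with more than two elements and
   [bottom_of i = b], with inverse [rank]. *)
Definition nontwo (b : option bool) (k : nat) : simple_index :=
  match b with
  | Some false => if k == 4 then Four None else Chain (odd k./2) (odd k) None
  | Some true => if k == 8 then Four (Some true)
                 else Chain (odd k./2./2) (odd k./2) (Some (true, odd k))
  | None => if k == 8 then Four (Some false)
            else Chain (odd k./2./2) (odd k./2) (Some (false, odd k))
  end.

Definition rank (i : simple_index) : nat :=
  match i with
  | Two _ => 0
  | Chain d w (Some (_, t)) => t + w.*2 + d.*2.*2
  | Chain d w None => w + d.*2
  | Four u => if u is None then 4 else 8
  end.

Definition is_two (i : simple_index) : bool := if i is Two _ then true else false.

Lemma bottom_nontwo b k : bottom_of (nontwo b k) = b.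
Proof. by case: b => [[]|] /=; case: (k == _). Qed.

Lemma is_two_nontwo b k : is_two (nontwo b k) = false.
Proof. by case: b => [[]|] /=; case: (k == _). Qed.

Lemma rank_nontwo b k : (k < if b == Some false then 5 else 9)%N ->
  rank (nontwo b k) = k.
Proof. by case: b => [[]|]; do 10?[case: k => // k]. Qed.

Lemma inord_rank_nontwo b n (k : 'I_n.+1) :
  n = (if b == Some false then 4 else 8) -> inord (rank (nontwo b k)) = k.
Proof.
move=> nb; rewrite rank_nontwo ?inord_val //.
by case: k => k /=; rewrite nb; case: ifP.
Qed.

Lemma nontwo_rank i : ~~ is_two i -> nontwo (bottom_of i) (rank i) = i.
Proof. by move: i; case_index. Qed.

Lemma rank_lt i : (rank i < if bottom_of i == Some false then 5 else 9)%N.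
Proof. by move: i; case_index. Qed.

(** [NewBottom] means that the two-element algebra, hence the whole group, is absent; [Old s]
    contains it and selects larger algebras by [s], so the default rank 0 of [Two] has no effect. *)
Definition in_part n (X : adjoin_bottom (boolean_lattice n.+1)) i : bool :=
  if X is Old s then is_two i || (inord (rank i) \in s) else false.

(** The groups hold 8 + 1, 4 + 1 and 8 + 1 larger algebras (chains plus one four-element algebra).
    The third has no two-element algebra, hence no adjoined bottom. *)
Definition target : latticeType _ :=
  ((adjoin_bottom (boolean_lattice 9) *p adjoin_bottom (boolean_lattice 5))
     *p boolean_lattice 9)%type.

Definition in_target (X : target) (i : simple_index) : bool :=
  match bottom_of i with
  | Some true => in_part X.1.1 i
  | Some false => in_part X.1.2 i
  | None => inord (rank i) \in X.2
  end.

Lemma in_part_le n c (X Y : adjoin_bottom (boolean_lattice n.+1)) :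
    n = (if c then 8 else 4) ->
  (forall i, bottom_of i = Some c -> in_part X i -> in_part Y i) -> X <= Y.
Proof.
move=> nc; case: X => [//|s]; case: Y => [|t] H.
  (* [Two c] distinguishes [Old s] from [NewBottom], even for empty [s]. *)
  by have := H (Two c) erefl isT.
change (s \subset t); apply/fintype.subsetP => k ks.
have := H (nontwo (Some c) k) (bottom_nontwo _ _).
rewrite /in_part is_two_nontwo inord_rank_nontwo; first exact.
by rewrite nc; case: (c).
Qed.

Lemma le_in_part n (X Y : adjoin_bottom (boolean_lattice n.+1)) i :
  X <= Y -> in_part X i -> in_part Y i.
Proof.
case: X Y => [|s] [|t] //= le_st.
have /fintype.subsetP st : s \subset t by [].
by case/orP => [->//|/st ->]; rewrite orbT.
Qed.

Lemma target_le (X Y : target) :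
  (X <= Y) <-> (forall i, in_target X i -> in_target Y i).
Proof.
case: X Y => [[X1 X0] Xm] [[Y1 Y0] Ym]; split=> [/andP[/andP[/= h1 h0] hm] i|H].
  rewrite /in_target /=; case: (bottom_of i) => [[]|]; try exact: le_in_part.
  by apply: (fintype.subsetP hm).
have h1 : X1 <= Y1.
  by apply: (@in_part_le 8 true) => // i ib; have := H i; rewrite /in_target ib.
have h0 : X0 <= Y0.
  by apply: (@in_part_le 4 false) => // i ib; have := H i; rewrite /in_target ib.
apply/andP; split; first by apply/andP; split.
apply/fintype.subsetP => k kX; have := H (nontwo None k).
by rewrite /in_target bottom_nontwo inord_rank_nontwo //=; apply.
Qed.

(** * The isomorphism: a subvariety is sent to the set of its simple members *)

Section Spectrum.
Variable K : subvariety RDQDStSH1.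

Definition member (i : simple_index) : bool := `[< K (simple_algebra i) >].

Definition part (n : nat) (c : bool) : adjoin_bottom (boolean_lattice n) :=
  if member (Two c) then Old [set k : 'I_n | member (nontwo (Some c) k)]
  else NewBottom.

Definition spectrum : target :=
  ((part 9 true, part 5 false), [set k : 'I_9 | member (nontwo None k)]).

Lemma in_part_part n c i : bottom_of i = Some c -> n = (if c then 8 else 4) ->
  in_part (part n.+1 c) i = member i.
Proof.
move=> ic nc; rewrite /in_part /part.
have down : member i -> member (Two c).
  by move/asboolP/(subvariety_bottom ic)/asboolP.
case: ifP => [mc|/negP mc]; last by apply/esym/negP => /down.
case: (boolP (is_two i)) => [|i2]; first by case: i ic {down} => //= c' [->].
rewrite orFb inE inordK -?ic ?nontwo_rank //.
by have := rank_lt i; rewrite ic nc; case: (c).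
Qed.

Lemma in_spectrum i : in_target spectrum i = member i.
Proof.
rewrite /in_target; case ic : (bottom_of i) => [[]|]; rewrite ?in_part_part //.
have i2 : ~~ is_two i by case: i ic.
have := rank_lt i; rewrite ic => r9.
by rewrite inE inordK // -ic nontwo_rank.
Qed.

End Spectrum.

Lemma spectrum_mono : {mono spectrum : K L / K <= L}.
Proof.
move=> K L; apply/idP/idP => [/target_le H|/subvariety_le_simple H].
  apply/subvariety_le_simple => i /asboolP Ki.
  by have := H i; rewrite !in_spectrum => /(_ Ki) /asboolP.
by apply/target_le => i; rewrite !in_spectrum => /asboolP/H/asboolP.
Qed.

Lemma spectrum_surj (X : target) : exists K, spectrum K = X.
Proof.
have [|K KX] := @subvariety_of_downset (in_target X).
  move=> i c ic; rewrite /in_target ic /=.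
  by case: c {ic}; rewrite /in_part; [case: X.1.1 | case: X.1.2].
exists K; apply/le_anti/andP.
by split; apply/target_le => i; rewrite in_spectrum => H;
  [apply/KX/asboolP | apply/asboolP/KX].
Qed.

Theorem theorem5p2 :
  lattice_isomorphic
    (subvariety RDQDStSH1)
    ((adjoin_bottom (boolean_lattice 9) *p adjoin_bottom (boolean_lattice 5))
       *p boolean_lattice 9).
Proof. exact: mono_lattice_isomorphic spectrum_mono spectrum_surj. Qed.
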